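(* Let $A$ be an associative algebra over a field $K$ and let $(M,\circ,\triangleright,\triangleleft,R,S)$ be an extended $A$-bimodule algebra. Define linear maps $\succ:M\otimes A\to A$, $\prec:A\otimes M\to A$ and $\gtrdot,\lessdot,\cdot:M\otimes M\to M$ by $$x\succ a=R(x)a,\quad a\prec x=aS(x),\quad x\gtrdot y=R(x)\triangleright y,\quad x\lessdot y=x\triangleleft S(y),\quad x\cdot y=x\circ y,$$ for $x,y\in M$, $a\in A$. If $(A,M,R,S,\circ)$ is a curved $\mathcal{O}$-operator system associated to $(M,\triangleright,\triangleleft)$, then $(M,A,\lessdot,\gtrdot,\cdot,\prec,\succ)$ is a tridendriform system.
   Context: All vector spaces, linear maps and tensor products are over a field $K$; associative algebras are not assumed to be unital. An $A$-bimodule $(M,\triangleright,\triangleleft)$ is a vector space $M$ with linear maps $\triangleright:A\otimes M\to M$, $\triangleleft:M\otimes A\to M$ such that $a\triangleright(b\triangleright x)=(ab)\triangleright x$, $(x\triangleleft a)\triangleleft b=x\triangleleft(ab)$, $(a\triangleright x)\triangleleft b=a\triangleright(x\triangleleft b)$ for all $a,b\in A$, $x\in M$. Extended $A$-bimodule algebra: let $A$ and $(M,\circ)$ be associative algebras and $\triangleright:A\otimes M\to M$, $\triangleleft:M\otimes A\to M$, $R,S:M\to A$ linear maps. $(M,\circ,\triangleright,\triangleleft,R,S)$ is an extended $A$-bimodule algebra if $(M,\triangleright,\triangleleft)$ is an $A$-bimodule and for all $x,y,z\in M$: $R(x)\triangleright(y\circ z)=(R(x)\triangleright y)\circ z$,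 $(x\circ y)\triangleleft S(z)=x\circ(y\triangleleft S(z))$, $x\circ(R(y)\triangleright z)=(x\triangleleft S(y))\circ z$. Curved $\mathcal{O}$-operator system: for an associative algebra $A$, an $A$-bimodule $(M,\triangleright,\triangleleft)$, linear maps $R,S:M\to A$ and a bilinear operation $\circ$ on $M$, $(A,M,R,S,\circ)$ is a curved $\mathcal{O}$-operator system associated to $(M,\triangleright,\triangleleft)$ if for all $x,y\in M$: $R(x)R(y)=R(R(x)\triangleright y+x\triangleleft S(y)+x\circ y)$ and $S(x)S(y)=S(R(x)\triangleright y+x\triangleleft S(y)+x\circ y)$. Tridendriform system: a tuple $(B,N,\prec_B,\succ_B,\cdot,\prec_N,\succ_N)$ of vector spaces $B,N$ and linear maps $\prec_B,\succ_B,\cdot:B\otimes B\to B$, $\prec_N:N\otimes B\to N$, $\succ_N:B\otimes N\to N$ such that for all $a,b,c\in B$, $n\in N$: (i) $(a\prec_B b)\prec_B c=a\prec_B(b\prec_B c+b\succ_B c+b\cdot c)$, $a\succ_B(b\prec_B c)=(a\succ_B b)\prec_B c$, $a\succ_B(b\succ_B c)=(a\prec_B b+a\succ_B b+a\cdot b)\succ_B c$, $(a\prec_B b)\cdot c=a\cdot(b\succ_B c)$, $(a\succ_B b)\cdot c=a\succ_B(b\cdot c)$, $(a\cdot b)\prec_B c=a\cdot(b\prec_B c)$, $(a\cdot b)\cdot c=a\cdot(b\cdot c)$; (ii) $(n\prec_N a)\prec_N b=n\prec_N(a\prec_B b+a\succ_B b+a\cdot b)$, $a\succ_N(n\prec_N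 b)=(a\succ_N n)\prec_N b$, $a\succ_N(b\succ_N n)=(a\prec_B b+a\succ_B b+a\cdot b)\succ_N n$. In the claim, $B=M$, $N=A$, $\prec_B=\lessdot$, $\succ_B=\gtrdot$, $\prec_N=\prec$, $\succ_N=\succ$. *)

(* Defs.v *)
From mathcomp Require Import all_boot all_algebra.

Set Implicit Arguments.
Unset Strict Implicit.
Unset Printing Implicit Defensive.

Import GRing.Theory.
Local Open Scope ring_scope.

(* A linear map U (x) V -> W is encoded as a curried bilinear map U -> V -> W. *)
Definition bilinear_map (K : fieldType) (U V W : lmodType K)
    (f : U -> V -> W) : Prop :=
  bilinear_for *:%R *:%R f.

(* MathComp's lalgType/algType are unital, so a not necessarily unital
   associative algebra is a vector space with an explicit product. *)
Record assoc_algebra (K : fieldType) (A : lmodType K) (mul : A -> A -> A)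
    : Prop := AssocAlgebra {
  assoc_algebra_bilinear : bilinear_map mul;
  assoc_algebra_assoc : associative mul
}.

Record bimodule (K : fieldType) (A M : lmodType K) (mul : A -> A -> A)
    (lact : A -> M -> M) (ract : M -> A -> M) : Prop := Bimodule {
  bimodule_lact_bilinear : bilinear_map lact;
  bimodule_ract_bilinear : bilinear_map ract;
  bimodule_lactA : forall a b x, lact a (lact b x) = lact (mul a b) x;
  bimodule_ractA : forall x a b, ract (ract x a) b = ract x (mul a b);
  bimodule_lractA : forall a x b, ract (lact a x) b = lact a (ract x b)
}.

Record extended_bimodule_algebra (K : fieldType) (A M : lmodType K)
    (mul : A -> A -> A) (circ : M -> M -> M)
    (lact : A -> M -> M) (ract : M -> A -> M) (R S : M -> A)
    : Prop := ExtendedBimoduleAlgebra {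
  extended_base_algebra : assoc_algebra mul;
  extended_algebra : assoc_algebra circ;
  extended_bimodule : bimodule mul lact ract;
  extended_R_linear : linear R;
  extended_S_linear : linear S;
  extended_lact_circ :
    forall x y z, lact (R x) (circ y z) = circ (lact (R x) y) z;
  extended_circ_ract :
    forall x y z, ract (circ x y) (S z) = circ x (ract y (S z));
  extended_circ_lact_ract :
    forall x y z, circ x (lact (R y) z) = circ (ract x (S y)) z
}.

Record curved_O_operator_system (K : fieldType) (A M : lmodType K)
    (mul : A -> A -> A) (lact : A -> M -> M) (ract : M -> A -> M)
    (R S : M -> A) (circ : M -> M -> M)
    : Prop := CurvedOOperatorSystem {
  curved_base_algebra : assoc_algebra mul;
  curved_bimodule : bimodule mul lact ract;
  curved_R_linear : linear R;
  curved_S_linear : linear S;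
  curved_circ_bilinear : bilinear_map circ;
  curved_R_mul : forall x y,
    mul (R x) (R y) = R (lact (R x) y + ract x (S y) + circ x y);
  curved_S_mul : forall x y,
    mul (S x) (S y) = S (lact (R x) y + ract x (S y) + circ x y)
}.

Record tridendriform_system (K : fieldType) (B N : lmodType K)
    (precB succB dot : B -> B -> B)
    (precN : N -> B -> N) (succN : B -> N -> N)
    : Prop := TridendriformSystem {
  tridendriform_precB_bilinear : bilinear_map precB;
  tridendriform_succB_bilinear : bilinear_map succB;
  tridendriform_dot_bilinear : bilinear_map dot;
  tridendriform_precN_bilinear : bilinear_map precN;
  tridendriform_succN_bilinear : bilinear_map succN;
  tridendriform_prec_prec : forall a b c,
    precB (precB a b) c = precB a (precB b c + succB b c + dot b c);
  tridendriform_succ_prec : forall a b c,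
    succB a (precB b c) = precB (succB a b) c;
  tridendriform_succ_succ : forall a b c,
    succB a (succB b c) = succB (precB a b + succB a b + dot a b) c;
  tridendriform_prec_dot : forall a b c,
    dot (precB a b) c = dot a (succB b c);
  tridendriform_succ_dot : forall a b c,
    dot (succB a b) c = succB a (dot b c);
  tridendriform_dot_prec : forall a b c,
    precB (dot a b) c = dot a (precB b c);
  tridendriform_dot_dot : forall a b c,
    dot (dot a b) c = dot a (dot b c);
  tridendriform_precN_precN : forall n a b,
    precN (precN n a) b = precN n (precB a b + succB a b + dot a b);
  tridendriform_succN_precN : forall a n b,
    succN a (precN n b) = precN (succN a n) b;
  tridendriform_succN_succN : forall a b n,
    succN a (succN b n) = succN (precB a b + succB a b + dot a b) n
}.

(* Main.v *)
Require Import Defs.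
From mathcomp Require Import all_boot all_algebra.

(** The curved O-operator equations say that [R] and [S] are multiplicative from
    [M], with the product [x * y = ract x (S y) + lact (R x) y + circ x y], to
    [A].  Hence multiplying, or acting, by [R x * R y] or [S x * S y] amounts to
    doing so by [R (x * y)] or [S (x * y)]; this turns the associativity of the
    actions on [M] and of the product of [A] into the four identities that
    involve [x * y].  Of the other six, the three relating [dot] to [gtrdot] and
    [lessdot] are the compatibility axioms of an extended bimodule algebra, one
    is the associativity of [circ], and two say that left and right actions
    commute, on [M] and on [A].  The operations are bilinear because [R] and [S]
    are linear. *)

Import GRing.Theory.
Local Open Scope ring_scope.

Section PrecomposeBilinear.
Context {K : fieldType} {U U' V V' W : lmodType K}.

Lemma bilinear_map_precompl (f : U -> V -> W) (g : U' -> U) :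
  bilinear_map f -> linear g -> bilinear_map (fun x y => f (g x) y).
Proof.
move=> [linl linr] ling; split=> [y a x x' | x] /=; last exact: linr.
by rewrite ling; exact: linl.
Qed.

Lemma bilinear_map_precompr (f : U -> V -> W) (g : V' -> V) :
  bilinear_map f -> linear g -> bilinear_map (fun x y => f x (g y)).
Proof.
move=> [linl linr] ling; split=> [y | x a y y'] /=; first exact: linl.
by rewrite ling; exact: linr.
Qed.

End PrecomposeBilinear.

Theorem theorem3p30 (K : fieldType) (A M : lmodType K)
    (mul : A -> A -> A) (circ : M -> M -> M)
    (lact : A -> M -> M) (ract : M -> A -> M) (R S : M -> A)
    (hext : extended_bimodule_algebra mul circ lact ract R S) :
  let succ : M -> A -> A := fun x a => mul (R x) a in
  let prec : A -> M -> A := fun a x => mul a (S x) in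
  let gtrdot : M -> M -> M := fun x y => lact (R x) y in
  let lessdot : M -> M -> M := fun x y => ract x (S y) in
  let dot : M -> M -> M := fun x y => circ x y in
  curved_O_operator_system mul lact ract R S circ ->
  tridendriform_system lessdot gtrdot dot prec succ.
Proof.
move=> succ prec gtrdot lessdot dot curved.
case: hext => [[mul_bilin mulA] [circ_bilin circA]].
case=> lact_bilin ract_bilin lactA ractA lractA linR linS.
move=> lact_circ circ_ract circ_lact_ract.
(* The sum is written in the order of the tridendriform axioms, which
   exchanges the first two summands of the curved equations. *)
have RM x y : R (ract x (S y) + lact (R x) y + circ x y) = mul (R x) (R y).
  by rewrite [X in X + _]addrC (curved_R_mul curved).
have SM x y : S (ract x (S y) + lact (R x) y + circ x y) = mul (S x) (S y).
  by rewrite [X in X + _]addrC (curved_S_mul curved).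
rewrite /succ /prec /gtrdot /lessdot /dot; split=> //.
- exact: bilinear_map_precompr.
- exact: bilinear_map_precompl.
- exact: bilinear_map_precompr.
- exact: bilinear_map_precompl.
- by move=> a b c; rewrite SM ractA.
- by move=> a b c; rewrite RM lactA.
- by move=> n a b; rewrite SM mulA.
- by move=> a b n; rewrite RM mulA.
Qed.
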